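(* Let $T$ be a tree. If $|L(T)|\geq 2(M(T)+2)$, then $\widetilde{T}\notin\mathfrak{N}_{c}$.
   Context: All graphs are finite, undirected, without loops or multiple edges. $d_G(v)$ is the degree of $v$ in $G$. Let $T$ be a tree with $V(T)=\{v_{1},\ldots,v_{n}\}$, $n\geq 2$. For vertices $v_i,v_j$, let $P(v_{i},v_{j})$ be the simple path joining $v_{i}$ and $v_{j}$ in $T$, and let $VP(v_{i},v_{j})$ and $EP(v_{i},v_{j})$ be its sets of vertices and edges. Let $L(T)=\{v\in V(T): d_{T}(v)=1\}$. Define $$LP(v_{i},v_{j})=|EP(v_{i},v_{j})|+\left|\left\{vw: vw\in E(T),\ v\in VP(v_{i},v_{j}),\ w\notin VP(v_{i},v_{j})\right\}\right|$$ and $M(T)=\max_{1\leq i<j\leq n}LP(v_{i},v_{j})$. The graph $\widetilde{T}$ is defined by $V(\widetilde{T})=V(T)\cup\{u\}$ with $u\notin V(T)$, and $E(\widetilde{T})=E(T)\cup\{uv: v\in L(T)\}$. For a positive integer $t$, an interval cyclic $t$-coloring of a graph $G$ is a proper edge-coloring of $G$ with colors $1,\ldots,t$ such that all $t$ colors are used and, for each vertex $v$, the edges incident to $v$ are colored by $d_{G}(v)$ consecutive colors modulo $t$ (i.e. consecutive in the cyclic order $1,2,\ldots,t,1$). $\mathfrak{N}_{c}$ is the set of graphs having an interval cyclic $t$-coloring for some positive integer $t$. *)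

(* Defs.v *)
From mathcomp Require Import all_boot.
Set Implicit Arguments.
Unset Strict Implicit.
Unset Printing Implicit Defensive.

Record sgraph := SGraph {
  vertex :> finType;
  adj : rel vertex;
  adj_sym : symmetric adj;
  adj_irrefl : irreflexive adj }.

Section Graph.
Variable G : sgraph.
Implicit Types (x y v w : G) (p : seq G) (f g : {set G}).

Definition edges : {set {set G}} := [set [set x; y] | x in G, y in G & adj x y].

Definition deg v : nat := #|[set w | adj v w]|.

(* [size c > 2] excludes the backtracking closed walks x, y, x. *)
Definition is_tree : Prop :=
  [/\ 0 < #|G|, forall x y, connect (@adj G) x y
    & forall c : seq G, 2 < size c -> ~ ucycle (@adj G) c].

Definition leaves : {set G} := [set v | deg v == 1].

(* As in [path], the path x :: p is given by its first vertex x and tail p. *)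
Definition simple_path x y p : bool :=
  [&& path (@adj G) x p, last x p == y & uniq (x :: p)].

(* The tail of a simple path from x to y: unique in a tree, an arbitrary one
   in other graphs, and [::] if there is none. The length bound loses nothing,
   since a simple path repeats no vertex. *)
Definition spath x y : seq G :=
  if [pick p : {bseq #|G| of G} | simple_path x y p] is Some p then p : seq G
  else [::].

Definition VP x y : {set G} := [set v in x :: spath x y].

Definition EP x y : {set {set G}} :=
  [set f in pairmap (fun v w => [set v; w]) x (spath x y)].

Definition LP x y : nat :=
  #|EP x y|
  + #|[set [set v; w] | v in VP x y, w in ~: VP x y & adj v w]|.

(* [LP] is symmetric on trees, so ordered pairs of distinct vertices give the
   same maximum as pairs i < j of indices. *)
Definition maxLP : nat := \max_(xy : G * G | xy.1 != xy.2) LP xy.1 xy.2.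

(* Colors are the numbers 1, ..., t; the values of c outside [edges] are
   irrelevant. *)
Definition proper_coloring (t : nat) (c : {set G} -> nat) : Prop :=
  (forall f, f \in edges -> 1 <= c f <= t) /\
  (forall f g v, f \in edges -> g \in edges -> f != g ->
     v \in f -> v \in g -> c f != c g).

Definition incident v : {set {set G}} := [set f in edges | v \in f].

(* The map k |-> (k %% t).+1 reduces modulo t into 1, ..., t, so the
   right-hand list is a run of [deg v] cyclically consecutive colors. *)
Definition interval_cyclic_coloring (t : nat) (c : {set G} -> nat) : Prop :=
  [/\ proper_coloring t c,
      forall k, 1 <= k <= t -> exists2 f, f \in edges & c f = k
    & forall v, exists a : nat,
        [seq c f | f in incident v]
          =i [seq ((a + i) %% t).+1 | i <- iota 0 (deg v)]].

Definition interval_cyclic_colorable : Prop :=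
  exists t : nat, 0 < t /\ exists c, interval_cyclic_coloring t c.

(* The new vertex u is [None]. *)
Definition tilde_adj : rel (option G) := fun a b =>
  match a, b with
  | Some x, Some y => adj x y
  | None, Some v | Some v, None => v \in leaves
  | None, None => false
  end.

Lemma tilde_adj_sym : symmetric tilde_adj.
Proof. by move=> [x|] [y|] //=; apply: adj_sym. Qed.

Lemma tilde_adj_irrefl : irreflexive tilde_adj.
Proof. by move=> [x|] //=; apply: adj_irrefl. Qed.

Definition tilde : sgraph := SGraph tilde_adj_sym tilde_adj_irrefl.

End Graph.

(* Main.v *)
Require Import Defs.
From mathcomp Require Import all_boot.
From mathcomp Require Import zify.

(** Let [u] be the new vertex, and suppose that [tilde T] has an interval
cyclic [t]-coloring.  Two edges meeting at [v] have colors at cyclic distance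
at most [deg v - 1], so along a walk the cyclic distance between the colors of
the first and the last edge is at most the sum of [deg v - 1] over the inner
vertices [v] of the walk ([walk_near]).

Apply this to the closed walk u, x, ..., y, u that runs from [u] through a
leaf [x] of [T], along the path of [T] from [x] to a leaf [y], and back to
[u].  As [T] has no cycle, the path has no chord, so each of its vertices [v]
has at most two neighbors on the path ([card_neighbors_on_path]).  If [v] is
not a leaf, then [deg v - 1] is at most one plus the number of edges that leave
the path at [v]; if [v] is a leaf, then its degree in [tilde T] is 2, and the
same bound holds.  Since the path has one vertex more than edges, summing gives
at most [LP x y + 1] ([sum_deg_path_le_LP]): the colors of [ux] and [uy] are at
cyclic distance at most [maxLP T + 1].

On the other hand, the edges at [u] carry [#|leaves T|] distinct, cyclically
consecutive colors.  Put h = #|leaves T|/2, so that h > maxLP T + 1.  The first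
of these colors and the one [h] steps further are at cyclic distance [h],
because [t >= #|leaves T| >= 2h].  This is a contradiction. *)

Set Implicit Arguments.
Unset Strict Implicit.
Unset Printing Implicit Defensive.

(** * Closeness modulo t *)

(** [near t D a b]: the residues of [a] and [b] modulo [t] are at cyclic
distance at most [D].  The displacement from [a] to [b] is written as the
difference of the natural numbers [i] and [j], which makes it additive along
chains without truncated subtraction. *)
Definition near (t D a b : nat) : Prop :=
  exists i j, i + j <= D /\ a + i = b + j %[mod t].

Lemma near_trans t D D' a b c :
  near t D a b -> near t D' b c -> near t (D + D') a c.
Proof.
move=> [i [j [leD eq_ab]]] [i' [j' [leD' eq_bc]]].
exists (i + i'), (j + j'); split; first by lia.
rewrite addnA -modnDml eq_ab modnDml addnAC -modnDml eq_bc modnDml.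
by congr (_ %% t); lia.
Qed.

Lemma modnDS t a k : (a %% t).+1 + k = a + k.+1 %[mod t].
Proof. by rewrite addSnnS modnDml. Qed.

Lemma near_run t d a i j : i < d -> j < d ->
  near t d.-1 ((a + i) %% t).+1 ((a + j) %% t).+1.
Proof.
move=> lt_id lt_jd; exists (j - i), (i - j); split; first by lia.
by rewrite !modnDS; congr (_ %% t); lia.
Qed.

(** Residues [h] steps apart are not closer than [h] when the circle has length
at least [2 * h]. *)
Lemma near_shift t D a h : 2 * h <= t ->
  near t D ((a + 0) %% t).+1 ((a + h) %% t).+1 -> h <= D.
Proof.
move=> le_ht [i [j [leD]]].
rewrite !modnDS addn0 leqNgt => eq_ah; apply/negP => ltDh.
have {eq_ah} : a.+1 + i == a.+1 + (h + j) %[mod t].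
  by apply/eqP; rewrite !addSnnS eq_ah; congr (_ %% t); lia.
rewrite eqn_modDl eq_sym eqn_mod_dvd; last by lia.
by move/dvdn_leq; lia.
Qed.

(** * Interval cyclic colorings along walks *)

Section Coloring.
Variables (G : sgraph) (t : nat) (c : {set G} -> nat).
Hypothesis c_int : interval_cyclic_coloring t c.

Lemma mem_incident (x y v : G) :
  adj x y -> v \in [set x; y] -> [set x; y] \in incident v.
Proof.
move=> xy v_xy; rewrite inE v_xy andbT.
by apply/imset2P; exists x y => //; rewrite inE.
Qed.

Lemma incident_near (v : G) f g : f \in incident v -> g \in incident v ->
  near t (deg v).-1 (c f) (c g).
Proof.
move=> vf vg; case: c_int => _ _ /(_ v) [a col].
have /mapP[i] : c f \in [seq ((a + i) %% t).+1 | i <- iota 0 (deg v)].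
  by rewrite -col; apply: image_f.
have /mapP[j] : c g \in [seq ((a + i) %% t).+1 | i <- iota 0 (deg v)].
  by rewrite -col; apply: image_f.
by rewrite !mem_iota /= => ltj -> lti ->; apply: near_run.
Qed.

(** The color of the last edge of a walk is within the sum of [deg v - 1] over
its inner vertices [v] of the color of the first edge.  The walk may be closed
and may repeat vertices. *)
Lemma walk_near (z x w : G) (p : seq G) :
  adj z x -> path (@adj G) x p -> adj (last x p) w ->
  near t (\sum_(v <- x :: p) (deg v).-1) (c [set z; x]) (c [set last x p; w]).
Proof.
elim: p z x => [|y p IHp] z x zx /=.
  by move=> _ xw; rewrite big_seq1; apply: incident_near; apply: mem_incident;
    rewrite // !inE eqxx ?orbT.
case/andP=> xy y_p last_w; rewrite big_cons.
apply: near_trans (IHp _ _ xy y_p last_w).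
by apply: incident_near; apply: mem_incident; rewrite // !inE eqxx ?orbT.
Qed.

Lemma deg_le_colors (v : G) : deg v <= t.
Proof.
case: c_int => -[c_range c_inj] _ _.
pose s := [seq c [set v; w] | w <- enum [set w | adj v w]].
have edge_v w : w \in enum [set w | adj v w] -> [set v; w] \in edges G.
  rewrite mem_enum inE => vw.
  by apply/imset2P; exists v w => //; rewrite inE.
have s_uniq : uniq s.
  rewrite map_inj_in_uniq ?enum_uniq // => w w' vw vw' eq_c.
  have vNw : w != v.
    by apply/eqP=> eq_wv; move: vw; rewrite eq_wv mem_enum inE adj_irrefl.
  apply/eqP/negPn/negP => neq_w.
  suff /(c_inj _ _ v (edge_v _ vw) (edge_v _ vw')) :
      [set v; w] != [set v; w'] by rewrite !set21 eq_c eqxx => /(_ isT isT).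
  apply: contra neq_w => /eqP/setP/(_ w).
  by rewrite !inE eqxx orbT (negbTE vNw) /= => /esym/eqP ->.
have := @uniq_leq_size _ s (iota 1 t) s_uniq.
rewrite size_map size_iota -cardE; apply=> _ /mapP[w vw ->].
by rewrite mem_iota add1n ltnS; apply: c_range; apply: edge_v.
Qed.

End Coloring.

(** * Simple paths in trees *)

Section Tree.
Variable T : sgraph.
Hypothesis hT : is_tree T.
Implicit Types (x y v w : T) (p : seq T).

Lemma spathP x y : simple_path x y (spath x y).
Proof.
rewrite /spath; case: pickP => [//|no_path].
have [_ /(_ x y)/connectP[p x_p y_last] _] := hT.
case/shortenP: x_p y_last => q x_q q_uniq _ y_last.
have size_q : size q <= #|T|.
  apply: ltnW; rewrite -[(size q).+1]/(size (x :: q)) -(card_uniqP q_uniq).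
  exact: max_card.
by have /idP[] := no_path (Bseq size_q); rewrite /simple_path x_q y_last eqxx.
Qed.

(** A simple path of a tree has no chord. *)
Lemma path_chordless x p i j :
  path (@adj T) x p -> uniq (x :: p) -> i.+1 < j -> j < size (x :: p) ->
  ~~ adj (nth x (x :: p) i) (nth x (x :: p) j).
Proof.
move=> x_p p_uniq lt_ij lt_j; apply/negP => chord.
(* The chord closes the segment c of the path between positions i and j. *)
pose c := drop i (take j.+1 (x :: p)).
have size_c : size c = j.+1 - i by rewrite size_drop size_takel.
have nth_c k : k < size c -> nth x c k = nth x (x :: p) (i + k).
  by move=> lt_k; rewrite nth_drop nth_take //; lia.
have [_ _ /(_ c)] := hT; apply; first by lia.
have c_sorted : sorted (@adj T) c.
  by apply: drop_sorted; apply: take_sorted.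
apply/andP; split; last by apply: drop_uniq; apply: take_uniq.
have last_c : last x c = nth x (x :: p) j.
  by rewrite -nth_last nth_c; [congr nth; lia | lia].
have head_c : nth x c 0 = nth x (x :: p) i by rewrite nth_c ?addn0 //; lia.
case: c size_c nth_c c_sorted last_c head_c => [|y q] /=; first by lia.
by move=> _ _ y_q last_q head_q; rewrite rcons_path y_q last_q head_q adj_sym.
Qed.

Lemma card_neighbors_on_path x p v :
  path (@adj T) x p -> uniq (x :: p) -> v \in x :: p ->
  #|[set w | adj v w & w \in x :: p]| <= 2.
Proof.
move=> x_p p_uniq v_p; set i := index v (x :: p).
have lt_i : i < size (x :: p) by rewrite index_mem.
have nth_i : nth x (x :: p) i = v by apply: nth_index.
suff /subset_leq_card/leq_trans -> : [set w | adj v w & w \in x :: p]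
    \subset [set nth x (x :: p) i.-1; nth x (x :: p) i.+1] => //.
  by rewrite cards2; case: eqP.
apply/subsetP=> w; rewrite in_set2 in_set => /andP[vw w_p].
set j := index w (x :: p).
have lt_j : j < size (x :: p) by rewrite index_mem.
have nth_j : nth x (x :: p) j = w by apply: nth_index.
have neq_ij : i != j.
  apply/eqP=> eq_ij; move: vw.
  by rewrite -nth_i -nth_j eq_ij adj_irrefl.
have [lt_ij|le_ji] := ltnP i.+1 j.
  by have := path_chordless x_p p_uniq lt_ij lt_j; rewrite nth_i nth_j vw.
have [lt_ji|le_ij] := ltnP j.+1 i.
  have := path_chordless x_p p_uniq lt_ji lt_i.
  by rewrite nth_i nth_j adj_sym vw.
have [<-|<-] : j = i.-1 \/ j = i.+1 by lia.
  by rewrite nth_j eqxx.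
by rewrite nth_j eqxx orbT.
Qed.

Lemma card_path_edges x p : uniq (x :: p) ->
  #|[set f in pairmap (fun v w => [set v; w]) x p]| = size p.
Proof.
move=> p_uniq; rewrite cardsE -(size_pairmap (fun v w => [set v; w]) x p).
apply/card_uniqP; elim: p x p_uniq => //= y p IHp x /andP[x_yp yp_uniq].
rewrite IHp // andbT; apply: contra x_yp => xy_p.
have sub_p z q g : g \in pairmap (fun v w => [set v; w]) z q ->
    {subset g <= z :: q}.
  elim: q z => //= z' q IHq z; rewrite inE => /predU1P[-> v|g_q v /(IHq _ g_q)].
    by rewrite !inE => /orP[] ->; rewrite ?orbT.
  by rewrite [in X in _ -> X]inE => ->; rewrite orbT.
by apply: (sub_p _ _ _ xy_p); rewrite set21.
Qed.

(** An edge with exactly one end in [A] determines that end, so boundary edges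
may be counted by their ends in [A]. *)
Lemma card_boundary (A : {set T}) :
  #|[set [set v; w] | v in A, w in ~: A & adj v w]|
    = \sum_(v in A) #|[set w | adj v w & w \notin A]|.
Proof.
pose S := [set vw : T * T | [&& vw.1 \in A, adj vw.1 vw.2 & vw.2 \notin A]].
transitivity #|S|.
  rewrite -(card_in_imset (f := fun vw => [set vw.1; vw.2]) (D := mem S)).
    apply: eq_card => f; apply/imset2P/imsetP=> [[v w vA]|[[v w]]].
      rewrite !inE => /andP[wA vw] ->.
      by exists (v, w) => //; rewrite inE /= vA vw wA.
    rewrite inE /= => /and3P[vA vw wA] ->.
    by exists v w => //; rewrite !inE wA vw.
  move=> [v w] [v' w']; rewrite !inE /= => /and3P[vA _ wA] /and3P[v'A _ w'A].
  move=> /setP eq_vw; have eq_in z z' : z \in A -> z' \notin A -> z != z'.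
    by move=> zA; apply: contraNneq => <-.
  have := eq_vw v; rewrite !inE eqxx (negbTE (eq_in _ _ vA w'A)) orbF /=.
  move/esym/eqP=> ->.
  have := eq_vw w.
  by rewrite !inE eqxx orbT eq_sym (negbTE (eq_in _ _ v'A wA)) => /esym/eqP ->.
rewrite -sum1_card; under [RHS]eq_bigr => v _ do rewrite -sum1_card.
by rewrite pair_big_dep /=; apply: eq_bigl => -[v w]; rewrite !inE.
Qed.

(** * The degrees along a path of T *)

Lemma deg_tilde v : deg (Some v : tilde T) = deg v + (v \in leaves T).
Proof.
rewrite /deg (cardD1 None) inE /= addnC; congr (_ + _).
rewrite -(card_imset _ (@Some_inj _)); apply: eq_card => -[w|]; rewrite !inE /=.
  by rewrite (mem_imset _ _ (@Some_inj _)) inE.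
by apply/esym/imsetP => -[].
Qed.

Lemma deg_tilde_None : deg (None : tilde T) = #|leaves T|.
Proof.
rewrite /deg -(card_imset (mem (leaves T)) (@Some_inj _)).
apply: eq_card => -[w|]; rewrite inE /=.
  by rewrite (mem_imset _ _ (@Some_inj _)).
by apply/esym/imsetP => -[].
Qed.

(** A vertex [v] of the path has degree at most 2 plus the number of boundary
edges at [v].  In [tilde T] this gives [deg v - 1] at most one plus that number,
also for a leaf of [T], whose degree becomes 2. *)
Lemma sum_deg_path_le_LP x y :
  \sum_(v <- x :: spath x y) (deg (Some v : tilde T)).-1 <= LP x y + 1.
Proof.
have /and3P[x_p _ p_uniq] := spathP x y.
rewrite /LP card_path_edges // card_boundary.
have -> : \sum_(v in VP x y) #|[set w | adj v w & w \notin VP x y]|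
    = \sum_(v <- x :: spath x y) #|[set w | adj v w & w \notin VP x y]|.
  by rewrite big_uniq //=; apply: eq_bigl => v; rewrite inE.
rewrite addnAC addn1 -[(size _).+1]/(size (x :: spath x y)) -sum1_size.
rewrite -big_split /= !big_seq; apply: leq_sum => v v_p.
rewrite deg_tilde inE; set out := [set w | _ & _].
have : deg v <= 2 + #|out|.
  apply: leq_trans (leq_add (card_neighbors_on_path x_p p_uniq v_p) (leqnn _)).
  rewrite -cardsUI; apply: leq_trans (leq_addr _ _).
  apply/subset_leq_card/subsetP => w; rewrite !inE => vw.
  by rewrite vw /= orbN.
by case: eqP => [->|_]; lia.
Qed.

End Tree.

Theorem theorem35 (T : sgraph) (hT : is_tree T) (hn : 2 <= #|T|)
  (hL : 2 * (maxLP T + 2) <= #|leaves T|) :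
  ~ interval_cyclic_colorable (tilde T).
Proof.
move=> [t [_ [c c_int]]]; set l := #|leaves T| in hL.
have le_lt : l <= t by rewrite /l -deg_tilde_None; apply: deg_le_colors c_int _.
have [_ _ /(_ None) [a col]] := c_int; rewrite deg_tilde_None -/l in col.
have leaf_color k : k < l -> exists2 x, x \in leaves T &
    c [set None; Some x] = ((a + k) %% t).+1.
  move=> lt_k.
  have : ((a + k) %% t).+1 \in [seq c f | f in incident (None : tilde T)].
    by rewrite col; apply/mapP; exists k; rewrite // mem_iota.
  case/imageP=> f; rewrite inE => /andP[/imset2P[v w _ vw ->]] + ->.
  rewrite !inE; case: v w vw => [v|] [w|]; rewrite !inE //= => vw _.
    by exists v => //; rewrite setUC.
  by exists w.
(* The first color at u and the one h steps further are far apart. *)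
pose h := l./2.
have le_hl : 2 * h <= l by rewrite /h; lia.
have [x x_leaf cx] := leaf_color 0 ltac:(lia).
have [y y_leaf cy] := leaf_color h ltac:(lia).
have /and3P[x_p /eqP last_p _] := spathP hT x y.
have := @walk_near _ _ _ c_int None (Some x) None (map Some (spath x y)).
rewrite path_map last_map last_p => /(_ x_leaf x_p y_leaf).
rewrite -map_cons big_map cx [[set Some y; None]]setUC cy => near_xy.
have := near_shift (leq_trans le_hl le_lt) near_xy.
have h_gt0 : 0 < h by lia.
have neq_xy : x != y.
  apply/eqP=> eq_xy; move: cy; rewrite -eq_xy cx => eq_ah.
  (* The shift by h would otherwise fix the color of the edge ux. *)
  suff : h <= 0 by lia.
  apply: (near_shift (a := a) (leq_trans le_hl le_lt)).
  by rewrite -eq_ah; exists 0, 0.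
have := leq_bigmax_cond (P := fun xy : T * T => xy.1 != xy.2)
  (F := fun xy => LP xy.1 xy.2) (x, y) neq_xy.
rewrite -/(maxLP T) /= => le_LP.
by have := sum_deg_path_le_LP hT x y; lia.
Qed.
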